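(* Let $A\in\mathbb{H}^n_{++}$, let $Q\in\mathbb{C}^{n\times n}$ be invertible, let $1\le r<n$, and let $\tilde E = Q^{-1}AQ^{-*}-I$. Suppose $V\in\mathbb{C}^{n\times r}$ and $D\in\mathbb{R}^{r\times r}$ have been chosen according to a Bregman log determinant truncation of $\tilde E$ to order $r$, i.e. $\langle\!\langle \tilde E\rangle\!\rangle_r = VDV^*$, and set $$P = Q(I+\langle\!\langle \tilde E\rangle\!\rangle_r)Q^*, \qquad P_\alpha = Q\big(\alpha(I-VV^* ) + V(I_r+D)V^*\big)Q^* \quad (\alpha>0).$$ Then $$\alpha^\star = \frac{\operatorname{tr}\big((I+\tilde E)(I-VV^* )\big)}{n-r} = \frac{\operatorname{tr}(P^{-1}A)-r}{n-r} = \frac{\sum_{i=r+1}^n \big(1+\mathfrak{b}_i(\tilde E)\big)}{n-r}$$ is the unique minimiser over $\alpha>0$ of $\alpha\mapsto \mathcal{D}_{\mathrm{LD}}(A,P_\alpha)$. Furthermore, for $\alpha=\alpha^\star$, $$\mathcal{D}_{\mathrm{LD}}(A,P_\alpha) = \ln K(P_\alpha^{-1}A) = -\ln\det(P_\alpha^{-1}A) = -\ln\det(P^{-1}A) + (n-r)\ln(\alpha).$$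
   Context: $\mathbb{H}^n_{++}$ denotes the set of $n\times n$ Hermitian positive definite matrices; $I$ is the $n\times n$ identity and $I_r$ the $r\times r$ identity; $Q^{-*}=(Q^{*})^{-1}$. For $A,P\in\mathbb{H}^n_{++}$ the Bregman log determinant divergence is $$\mathcal{D}_{\mathrm{LD}}(A,P) = \operatorname{tr}(AP^{-1}) - \ln\det(AP^{-1}) - n.$$ For an $n\times n$ matrix $M$ with positive real eigenvalues, Kaporin's condition number is $K(M) = \big(\tfrac1n\operatorname{tr}(M)\big)^n/\det(M)$. Bregman log determinant truncation: let $X$ be Hermitian with $I+X\in\mathbb{H}^n_{++}$ and let $\gamma(\lambda)=\lambda-\ln(1+\lambda)$ for $\lambda>-1$. Let $\mathfrak{b}_1(X),\dots,\mathfrak{b}_n(X)$ be the eigenvalues of $X$ (with multiplicity) enumerated so that $\gamma(\mathfrak{b}_1(X))\ge\cdots\ge\gamma(\mathfrak{b}_n(X))$ (ties broken arbitrarily), and let $z_1,\dots,z_n$ be corresponding orthonormal eigenvectors. The truncation of $X$ to order $r$ is $$\langle\!\langle X\rangle\!\rangle_r = [z_1|\cdots|z_r]\,\operatorname{diag}(\mathfrak{b}_1(X),\dots,\mathfrak{b}_r(X))\,[z_1|\cdots|z_r]^*.$$ ''$V,D$ chosen according to a Bregman truncation of $\tilde E$'' means $V=[z_1|\cdots|z_r]$ (so $V^*V=I_r$) and $D=\operatorname{diag}(\mathfrak{b}_1(\tilde E),\dots,\mathfrak{b}_r(\tilde E))$. Note $A = Q(I+\tilde E)Q^*$. *)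

(* Defs.v *)
(* MathComp / MathComp-Analysis: complex matrices are 'M[R[i]]_n for R : realType *)
From HB Require Import structures.
From mathcomp Require Import all_boot all_order all_algebra.
From mathcomp Require Import complex.
From mathcomp Require Import reals exp.

Set Implicit Arguments.
Unset Strict Implicit.
Unset Printing Implicit Defensive.

Import Order.TTheory GRing.Theory Num.Theory.
Local Open Scope ring_scope.
Local Open Scope sesquilinear_scope.

Definition posdefmx (R : realType) (n : nat) (M : 'M[R[i]]_n) : Prop :=
  M \is hermsymmx /\
  forall x : 'cV[R[i]]_n, x != 0 -> 0 < (x ^t* *m M *m x) 0 0.

(* If A and P are Hermitian positive definite, then A *m invmx P and
   invmx P *m A have positive real eigenvalues, so the traces and determinants
   below are positive reals and [complex.Re] only moves them from R[i] to R. *)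
Definition rtrace (R : realType) (n : nat) (M : 'M[R[i]]_n) : R :=
  complex.Re (\tr M).

Definition rdet (R : realType) (n : nat) (M : 'M[R[i]]_n) : R :=
  complex.Re (\det M).

Definition logdet_div (R : realType) (n : nat) (A P : 'M[R[i]]_n) : R :=
  rtrace (A *m invmx P) - ln (rdet (A *m invmx P)) - n%:R.

Definition kaporin (R : realType) (n : nat) (M : 'M[R[i]]_n) : R :=
  (n%:R^-1 * rtrace M) ^+ n / rdet M.

(* Used only for l > -1. *)
Definition bregman_gamma (R : realType) (l : R) : R := l - ln (1 + l).

(* The columns of Z are orthonormal eigenvectors of X and b lists the
   corresponding eigenvalues; as Z is square, each eigenvalue occurs in b with
   its multiplicity. Ties in the ordering are left unconstrained, so every
   admissible enumeration satisfies this predicate. Indices start at 0. *)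
Definition bregman_eigensystem (R : realType) (n : nat) (X : 'M[R[i]]_n)
    (b : 'I_n -> R) (Z : 'M[R[i]]_n) : Prop :=
  [/\ Z ^t* *m Z = 1%:M,
      forall i : 'I_n, X *m col i Z = (b i)%:C%C *: col i Z &
      forall i j : 'I_n, (i <= j)%N ->
        bregman_gamma (b j) <= bregman_gamma (b i)].

Definition leading_vectors (R : realType) (n r : nat) (le_rn : (r <= n)%N)
    (Z : 'M[R[i]]_n) : 'M[R[i]]_(n, r) :=
  colsub (widen_ord le_rn) Z.

Definition leading_values (R : realType) (n r : nat) (le_rn : (r <= n)%N)
    (b : 'I_n -> R) : 'M[R]_r :=
  diag_mx (\row_j b (widen_ord le_rn j)).

Definition complexmx (R : realType) (m n : nat) (M : 'M[R]_(m, n)) :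
    'M[R[i]]_(m, n) :=
  map_mx (real_complex R) M.

(* The order r truncation determined by the eigensystem (b, Z). *)
Definition bregman_truncation (R : realType) (n r : nat) (le_rn : (r <= n)%N)
    (b : 'I_n -> R) (Z : 'M[R[i]]_n) : 'M[R[i]]_n :=
  leading_vectors le_rn Z *m complexmx (leading_values le_rn b)
    *m (leading_vectors le_rn Z) ^t*.

Definition minimiser_on (R : realType) (S : R -> Prop) (f : R -> R) (x : R) :
    Prop :=
  S x /\ forall y : R, S y -> f x <= f y.

(* Main.v *)
Require Import Defs.
From HB Require Import structures.
From mathcomp Require Import all_boot all_order all_algebra.
From mathcomp Require Import complex.
From mathcomp Require Import reals exp.
From mathcomp Require Import ring lra.

Set Implicit Arguments.
Unset Strict Implicit.
Unset Printing Implicit Defensive.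

Import Order.TTheory GRing.Theory Num.Theory.
Local Open Scope ring_scope.
Local Open Scope sesquilinear_scope.

(** Let [a i = 1 + b i]. In the eigenbasis [Z] of [E] every matrix of the theorem
    becomes diagonal: with [W = Q *m Z], the matrix [A] is [congdiag W a], and
    [P_ alpha] is [congdiag W] of the sequence that agrees with [a] on the first
    [r] indices and is constantly [alpha] afterwards. The unscaled [P] is the case
    [alpha = 1]. Positive definiteness of [A] makes every [a i] positive.

    Two matrices diagonalised by one congruence have a quotient similar to the
    diagonal of the ratios ([mxtrace_mul_invmx_congdiag],
    [det_mul_invmx_congdiag], [logdet_div_congdiag]). The first [r] ratios are 1
    and the others are [a i / alpha]. Writing [m = n - r], [m * alpha_star] for
    the sum and [c] for the product of the tail of [a], this gives
    - trace of the quotient: [r + m * alpha_star / alpha];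
    - log-determinant of the quotient: [ln c - m * ln alpha];
    - divergence: [m * (alpha_star / alpha - 1 + ln alpha) - ln c].

    The minimisation is thus a scalar problem, solved by [ln t < t - 1] for
    [t != 1] at [t = alpha_star / alpha] ([unique_minimiser_log]). At
    [alpha_star] the trace is exactly [n], so the trace term of the divergence
    cancels [n] and the numerator of the Kaporin number is 1: both quantities
    reduce to minus the log-determinant. *)

(** * Matrices diagonalised by a congruence *)

Definition realdiag (R : realType) (n : nat) (d : 'I_n -> R) : 'M[R[i]]_n :=
  diag_mx (\row_j (d j)%:C%C).

(** For invertible [W] this is a congruence; when [W] is unitary it is also the
    similarity whose diagonal lists eigenvalues. *)
Definition congdiag (R : realType) (n : nat) (W : 'M[R[i]]_n) (d : 'I_n -> R) :
    'M[R[i]]_n :=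
  W *m realdiag d *m W ^t*.

Section RealDiagonal.
Variables (R : realType) (n : nat).
Implicit Types (d e : 'I_n -> R) (W Q Z : 'M[R[i]]_n).

Lemma eq_realdiag d e : d =1 e -> realdiag d = realdiag e.
Proof. by move=> de; congr diag_mx; apply/rowP => j; rewrite !mxE de. Qed.

Lemma eq_congdiag W d e : d =1 e -> congdiag W d = congdiag W e.
Proof. by move=> de; rewrite /congdiag (eq_realdiag de). Qed.

Lemma realdiag1 : realdiag (fun _ : 'I_n => 1) = 1%:M :> 'M[R[i]]_n.
Proof. by apply/matrixP => i j; rewrite !mxE rmorph1. Qed.

Lemma mul_realdiag d e :
  realdiag d *m realdiag e = realdiag (fun i => d i * e i).
Proof.
by rewrite mulmx_diag; congr diag_mx; apply/rowP => j; rewrite !mxE rmorphM.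
Qed.

Lemma realdiag_unit d : (forall i, d i != 0) -> realdiag d \in unitmx.
Proof.
move=> d0; suff /mulmx1_unit[] :
  realdiag d *m realdiag (fun i => (d i)^-1) = 1%:M by [].
rewrite mul_realdiag -realdiag1; apply: eq_realdiag => i.
by rewrite divff.
Qed.

Lemma invmx_realdiag d : (forall i, d i != 0) ->
  invmx (realdiag d) = realdiag (fun i => (d i)^-1).
Proof.
move=> d0; apply: (can_inj (mulKmx (realdiag_unit d0))).
rewrite mulmxV ?realdiag_unit // mul_realdiag -realdiag1.
by apply: eq_realdiag => i; rewrite divff.
Qed.

Lemma mxtrace_realdiag d : \tr (realdiag d) = (\sum_i d i)%:C%C.
Proof.
by rewrite mxtrace_diag rmorph_sum; apply: eq_bigr => i _; rewrite mxE.
Qed.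

Lemma det_realdiag d : \det (realdiag d) = (\prod_i d i)%:C%C.
Proof.
by rewrite det_diag rmorph_prod; apply: eq_bigr => i _; rewrite mxE.
Qed.

Lemma congdiagD W d e :
  congdiag W d + congdiag W e = congdiag W (fun i => d i + e i).
Proof.
rewrite /congdiag -mulmxDl -mulmxDr; congr (_ *m _ *m _).
by apply/matrixP => i j; rewrite !mxE -mulrnDl rmorphD.
Qed.

Lemma congdiagZ W (c : R) d :
  c%:C%C *: congdiag W d = congdiag W (fun i => c * d i).
Proof.
rewrite /congdiag scalemxAl scalemxAr; congr (_ *m _ *m _).
by apply/matrixP => i j; rewrite !mxE rmorphM mulrnAr.
Qed.

Lemma congdiagM Q W d : Q *m congdiag W d *m Q ^t* = congdiag (Q *m W) d.
Proof. by rewrite /congdiag trmx_mul map_mxM !mulmxA. Qed.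

Lemma conjt_unit W : W \in unitmx -> W ^t* \in unitmx.
Proof. by rewrite map_unitmx unitmx_tr. Qed.

Lemma invmx_congdiag W d : W \in unitmx -> (forall i, d i != 0) ->
  invmx (congdiag W d)
  = invmx (W ^t*) *m realdiag (fun i => (d i)^-1) *m invmx W.
Proof.
move=> uW d0; have uWt := conjt_unit uW; have uD := realdiag_unit d0.
have uC : congdiag W d \in unitmx by rewrite !unitmx_mul uW uD uWt.
apply: (can_inj (mulKmx uC)); rewrite mulmxV // -invmx_realdiag // /congdiag.
by rewrite !mulmxA (mulmxK uWt) (mulmxK uD) mulmxV.
Qed.

(** Two Hermitian matrices that are diagonal under the same congruence have a
    quotient similar to the diagonal matrix of the entrywise ratios: the factors
    [W ^t*] (or [W]) outside cancel in traces and determinants. *)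
Section Quotient.
Variables (W : 'M[R[i]]_n) (d e : 'I_n -> R).
Hypotheses (uW : W \in unitmx) (d0 : forall i, d i != 0).

Lemma mul_invmx_congdiag : invmx (congdiag W d) *m congdiag W e
  = invmx (W ^t*) *m realdiag (fun i => e i / d i) *m W ^t*.
Proof.
rewrite (invmx_congdiag uW d0) /congdiag.
rewrite !mulmxA (mulmxKV uW) -(mulmxA (invmx _) (realdiag _)).
rewrite mul_realdiag.
by rewrite (eq_realdiag (fun i => mulrC (d i)^-1 (e i))).
Qed.

Lemma mul_congdiag_invmx : congdiag W e *m invmx (congdiag W d)
  = W *m realdiag (fun i => e i / d i) *m invmx W.
Proof.
rewrite (invmx_congdiag uW d0) /congdiag !mulmxA (mulmxK (conjt_unit uW)).
by rewrite -(mulmxA W) mul_realdiag.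
Qed.

Lemma mxtrace_mul_invmx_congdiag :
  \tr (invmx (congdiag W d) *m congdiag W e) = (\sum_i e i / d i)%:C%C.
Proof.
by rewrite mul_invmx_congdiag mxtrace_mulC mulKVmx ?conjt_unit //
  mxtrace_realdiag.
Qed.

Lemma det_mul_invmx_congdiag :
  \det (invmx (congdiag W d) *m congdiag W e) = (\prod_i (e i / d i))%:C%C.
Proof.
rewrite mul_invmx_congdiag !det_mulmx mulrAC -det_mulmx mulVmx ?conjt_unit //.
by rewrite det1 mul1r det_realdiag.
Qed.

Lemma logdet_div_congdiag : logdet_div (congdiag W e) (congdiag W d)
  = \sum_i e i / d i - ln (\prod_i (e i / d i)) - n%:R.
Proof.
rewrite /logdet_div /rtrace /rdet ![congdiag W e *m _]mul_congdiag_invmx.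
rewrite mxtrace_mulC mulKmx // mxtrace_realdiag /=.
by rewrite !det_mulmx mulrAC -det_mulmx mulmxV // det1 mul1r det_realdiag.
Qed.

End Quotient.

Lemma unitary_eigendecomposition X Z (b : 'I_n -> R) : Z ^t* *m Z = 1%:M ->
  (forall i, X *m col i Z = (b i)%:C%C *: col i Z) -> X = congdiag Z b.
Proof.
move=> ZZ1 XZ; have ZZ2 := mulmx1C ZZ1.
rewrite /congdiag -[X]mulmx1 -ZZ2 mulmxA; congr (_ *m _).
apply/matrixP => i j; have /colP/(_ i) := XZ j.
rewrite {1}colE mulmxA -colE mul_mx_diag.
by rewrite !mxE mulrC.
Qed.

Lemma congdiag_unitary1 Z : Z ^t* *m Z = 1%:M ->
  congdiag Z (fun=> 1) = 1%:M.
Proof. by move=> ZZ1; rewrite /congdiag realdiag1 mulmx1 (mulmx1C ZZ1). Qed.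

Lemma mxtrace_mul_congdiag_unitary Z d e : Z ^t* *m Z = 1%:M ->
  \tr (congdiag Z d *m congdiag Z e) = (\sum_i d i * e i)%:C%C.
Proof.
move=> ZZ1; rewrite /congdiag !mulmxA mxtrace_mulC !mulmxA ZZ1 mul1mx.
rewrite -(mulmxA (realdiag d) (Z ^t*) Z) ZZ1 mulmx1 mul_realdiag.
exact: mxtrace_realdiag.
Qed.

(** Keeping the first [r] columns of [Z] is the same as keeping all of them and
    giving the others the weight zero, which puts every truncated matrix in the
    form [congdiag Z _]. *)
Lemma leading_congdiag r (le_rn : (r <= n)%N) Z d :
  leading_vectors le_rn Z *m diag_mx (\row_j (d (widen_ord le_rn j))%:C%C)
    *m (leading_vectors le_rn Z) ^t*
  = congdiag Z (fun i => if (i < r)%N then d i else 0).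
Proof.
rewrite /congdiag !mul_mx_diag; apply/matrixP => i j; rewrite !mxE.
rewrite (bigID (fun k : 'I_n => (k < r)%N)) /= [X in _ + X]big1 ?addr0.
  rewrite big_ord_narrow; apply: eq_bigr => k _.
  by rewrite !mxE /= ltn_ord.
by move=> k /negbTE rk; rewrite !mxE rk mulr0 mul0r.
Qed.

(** The conjugate transpose of [W] is invertible, hence some vector [x] is sent by
    it to the [i]-th basis vector; the quadratic form at [x] is then [d i]. *)
Lemma posdef_congdiag_gt0 W d : W \in unitmx -> posdefmx (congdiag W d) ->
  forall i, 0 < d i.
Proof.
move=> uW [_ pos] i; have uWt := conjt_unit uW.
pose x : 'cV[R[i]]_n := invmx (W ^t*) *m delta_mx i 0.
have Wx : W ^t* *m x = delta_mx i 0 by rewrite mulKVmx.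
have /pos : x != 0.
  apply/eqP => x0; move: Wx; rewrite x0 mulmx0 => /matrixP/(_ i 0).
  by rewrite !mxE !eqxx => /eqP; rewrite eq_sym oner_eq0.
have xW : x ^t* *m W = delta_mx 0 i.
  rewrite -[W in x ^t* *m W]trmxCK -map_mxM -trmx_mul Wx trmx_delta.
  by rewrite map_delta_mx.
rewrite /congdiag !mulmxA xW (mulmxK uWt) -rowE -colE !mxE eqxx.
by rewrite mulr1n ltcR.
Qed.

End RealDiagonal.

(** * The scalar minimisation *)

Lemma ln_lt_sub1 (R : realType) (t : R) : 0 < t -> t != 1 -> ln t < t - 1.
Proof.
move=> t0 t1; rewrite ltrBrDl -[ltRHS]lnK //; apply: expR_gt1Dx.
by rewrite ln_eq0.
Qed.

(** With [t = s / x], the value at [x] exceeds the value at [s] by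
    [m * (t - 1 - ln t)], which is positive for [t != 1] by strict concavity of
    the logarithm. *)
Lemma unique_minimiser_log (R : realType) (f : R -> R) (m s k : R) :
  0 < m -> 0 < s ->
  (forall x, 0 < x -> f x = m * (s / x - 1 + ln x) + k) ->
  unique (minimiser_on (fun x => 0 < x) f) s.
Proof.
move=> m0 s0 fE.
have gap x : 0 < x -> x != s -> f s < f x.
  move=> x0 xs; rewrite !fE // ltrD2r ltr_pM2l // divff ?gt_eqF //.
  have sx0 : 0 < s / x by rewrite divr_gt0.
  have sx1 : s / x != 1 by apply: contra xs => /eqP/divr1_eq ->.
  by have := ln_lt_sub1 sx0 sx1; rewrite ln_div ?posrE //; lra.
split=> [|x [x0 min_x]].
  by split=> // x x0; have [->|/gap/ltW ->] := eqVneq x s.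
apply/eqP; rewrite eq_sym; apply: contraT => xs.
by have := lt_le_trans (gap _ x0 xs) (min_x _ s0); rewrite ltxx.
Qed.

(** * Traces and determinants after flattening the tail *)

Lemma big_split_lt (T : Type) (idx : T) (op : Monoid.com_law idx) n r
    (f g : 'I_n -> T) :
  \big[op/idx]_(i < n) (if (i < r)%N then f i else g i)
  = op (\big[op/idx]_(i < n | (i < r)%N) f i)
       (\big[op/idx]_(i < n | (r <= i)%N) g i).
Proof.
rewrite (bigID (fun i : 'I_n => (i < r)%N)) /=; congr (op _ _).
  by apply: eq_bigr => i ->.
by apply: eq_big => i; rewrite -leqNgt // => /leq_gtF ->.
Qed.

Lemma card_ord_lt n r : (r <= n)%N -> #|[pred i : 'I_n | (i < r)%N]| = r.
Proof.
move=> le_rn; rewrite -sum1_card (big_ord_narrow le_rn) sum1_card.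
exact: card_ord.
Qed.

Lemma card_ord_ge n r :
  (r <= n)%N -> #|[pred i : 'I_n | (r <= i)%N]| = (n - r)%N.
Proof.
move=> le_rn; have := cardC [pred i : 'I_n | (i < r)%N].
rewrite card_ord_lt // card_ord => /(congr1 (subn^~ r)) /=.
by rewrite addKn => <-; apply: eq_card => i; rewrite !inE -leqNgt.
Qed.

(** The diagonal of the scaled preconditioner: the leading [r] entries of [a] are
    matched exactly and the remaining ones are replaced by one constant. *)
Definition flatten_tail (R : realType) (n r : nat) (a : 'I_n -> R) (alpha : R)
    (i : 'I_n) : R :=
  if (i < r)%N then a i else alpha.

Section FlattenTail.
Variables (R : realType) (n r : nat) (a : 'I_n -> R).
Hypotheses (le_rn : (r <= n)%N) (a_gt0 : forall i, 0 < a i).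

Lemma sum_tail_gt0 : (r < n)%N -> 0 < \sum_(i < n | (r <= i)%N) a i.
Proof.
move=> lt_rn; rewrite (bigD1 (Ordinal lt_rn)) //= ltr_wpDr // sumr_ge0 //.
by move=> i _; exact: ltW.
Qed.

Lemma flatten_tail_neq0 (alpha : R) :
  0 < alpha -> forall i, flatten_tail r a alpha i != 0.
Proof.
by move=> al i; rewrite /flatten_tail; case: ifP => _; rewrite gt_eqF.
Qed.

Lemma ratio_flatten_tail (alpha : R) i :
  a i / flatten_tail r a alpha i = if (i < r)%N then 1 else a i / alpha.
Proof. by rewrite /flatten_tail; case: ifP; rewrite // divff // gt_eqF. Qed.

Lemma sum_ratio_flatten_tail (alpha : R) :
  \sum_i a i / flatten_tail r a alpha i
  = r%:R + (\sum_(i < n | (r <= i)%N) a i) / alpha.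
Proof.
under eq_bigr => i _ do rewrite ratio_flatten_tail.
by rewrite big_split_lt /= sumr_const card_ord_lt // mulr_suml.
Qed.

Lemma prod_ratio_flatten_tail (alpha : R) :
  \prod_i (a i / flatten_tail r a alpha i)
  = (\prod_(i < n | (r <= i)%N) a i) / alpha ^+ (n - r).
Proof.
under eq_bigr => i _ do rewrite ratio_flatten_tail.
rewrite big_split_lt /= big1_eq mul1r big_split prodr_const card_ord_ge //.
by rewrite exprVn.
Qed.

Lemma ln_prod_ratio_flatten_tail (alpha : R) : 0 < alpha ->
  ln (\prod_i (a i / flatten_tail r a alpha i))
  = ln (\prod_(i < n | (r <= i)%N) a i) - (n%:R - r%:R) * ln alpha.
Proof.
move=> al; rewrite prod_ratio_flatten_tail ln_div ?posrE ?exprn_gt0 //.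
  by rewrite lnXn // -natrB // mulr_natl.
by apply: prodr_gt0.
Qed.

End FlattenTail.

(** * The optimal scaling *)

Theorem theorem3 (R : realType) (n r : nat) (A Q : 'M[R[i]]_n)
    (hA : posdefmx A) (hQ : Q \in unitmx)
    (r_ge1 : (1 <= r)%N) (lt_rn : (r < n)%N)
    (E : 'M[R[i]]_n) (hE : E = invmx Q *m A *m invmx (Q ^t*) - 1%:M)
    (b : 'I_n -> R) (Z : 'M[R[i]]_n) (hbZ : bregman_eigensystem E b Z)
    (V : 'M[R[i]]_(n, r)) (hV : V = leading_vectors (ltnW lt_rn) Z)
    (D : 'M[R]_r) (hD : D = leading_values (ltnW lt_rn) b) :
  let P : 'M[R[i]]_n :=
    Q *m (1%:M + bregman_truncation (ltnW lt_rn) b Z) *m Q ^t* in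
  let P_ (alpha : R) : 'M[R[i]]_n :=
    Q *m (alpha%:C%C *: (1%:M - V *m V ^t*)
          + V *m (1%:M + complexmx D) *m V ^t*) *m Q ^t* in
  let alpha_star : R :=
    (\sum_(i < n | (r <= i)%N) (1 + b i)) / (n%:R - r%:R) in
  [/\ alpha_star%:C%C
        = \tr ((1%:M + E) *m (1%:M - V *m V ^t*)) / (n%:R - r%:R),
      alpha_star%:C%C = (\tr (invmx P *m A) - r%:R) / (n%:R - r%:R),
      unique (minimiser_on (fun alpha : R => 0 < alpha)
                (fun alpha : R => logdet_div A (P_ alpha))) alpha_star &
      [/\ logdet_div A (P_ alpha_star)
            = ln (kaporin (invmx (P_ alpha_star) *m A)),
          ln (kaporin (invmx (P_ alpha_star) *m A))
            = - ln (rdet (invmx (P_ alpha_star) *m A)) &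
          - ln (rdet (invmx (P_ alpha_star) *m A))
            = - ln (rdet (invmx P *m A))
              + (n%:R - r%:R) * ln alpha_star]].
Proof.
move=> P P_ alpha_star; case: hbZ => ZZ EZ _.
pose a i : R := 1 + b i; pose q := flatten_tail r a; pose W := Q *m Z.
pose c : R := \prod_(i < n | (r <= i)%N) a i.
have le_rn := ltnW lt_rn.
have [_ uZ] := mulmx1_unit ZZ.
have uW : W \in unitmx by rewrite unitmx_mul hQ.
have Eb : E = congdiag Z b by exact: unitary_eigendecomposition.
have one_diag : 1%:M = congdiag Z (fun=> 1) by rewrite congdiag_unitary1.
have IE : 1%:M + E = congdiag Z a by rewrite Eb one_diag congdiagD.
have AE : A = congdiag W a.
  rewrite -congdiagM -IE hE subrKC !mulmxA (mulmxV hQ) mul1mx.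
  by rewrite (mulmxKV (conjt_unit hQ)).
have a0 : forall i, 0 < a i.
  by apply: (posdef_congdiag_gt0 uW); rewrite -AE.
(* The cases needed are [B] equal to 1, to [D] and to [1 + D]. *)
have VdV (d : 'I_n -> R) (B : 'M[R[i]]_r) :
    B = diag_mx (\row_j (d (widen_ord (ltnW lt_rn) j))%:C%C) ->
    V *m B *m V ^t* = congdiag Z (fun i => if (i < r)%N then d i else 0).
  by move=> ->; rewrite hV leading_congdiag.
have VV : V *m V ^t* = congdiag Z (fun i => if (i < r)%N then 1 else 0).
  rewrite -(VdV (fun=> 1) 1%:M) ?mulmx1 //.
  by apply/matrixP => i j; rewrite !mxE rmorph1.
have DE : complexmx D
    = diag_mx (\row_j (b (widen_ord (ltnW lt_rn) j))%:C%C).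
  by rewrite hD; apply/matrixP => i j; rewrite !mxE rmorphMn.
have IDE : 1%:M + complexmx D
    = diag_mx (\row_j (a (widen_ord (ltnW lt_rn) j))%:C%C).
  rewrite DE; apply/matrixP => i j; rewrite !mxE -mulrnDl.
  by rewrite rmorphD rmorph1.
have coproj : 1%:M - V *m V ^t*
    = congdiag Z (fun i => if (i < r)%N then 0 else 1).
  rewrite VV one_diag -scaleN1r -[in X in X *: _](rmorph1 (real_complex R)).
  rewrite -rmorphN congdiagZ congdiagD; apply: eq_congdiag => i.
  by case: ifP => _; rewrite mulN1r ?subrr ?subr0.
have PaE al : P_ al = congdiag W (q al).
  rewrite /P_ coproj (VdV _ _ IDE) congdiagZ congdiagD congdiagM.
  apply: eq_congdiag => i; rewrite /q /flatten_tail.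
  by case: ifP => _; rewrite ?mulr0 ?mulr1 ?add0r ?addr0.
have PE : P = congdiag W (q 1).
  rewrite /P /bregman_truncation -hV -hD (VdV _ _ DE) one_diag congdiagD.
  rewrite congdiagM; apply: eq_congdiag => i; rewrite /q /flatten_tail.
  by case: ifP => _; rewrite ?addr0.
(* Replacing the discarded eigenvalues of [E] by 0 makes those of [1 + E] equal
   to 1, so the plain truncation is the scaled one at 1. *)
have P1 : P = P_ 1 by rewrite PE PaE.
have m0 : 0 < n%:R - r%:R :> R by rewrite subr_gt0 ltr_nat.
have S0 : 0 < \sum_(i < n | (r <= i)%N) a i := sum_tail_gt0 a0 lt_rn.
have as0 : 0 < alpha_star by exact: divr_gt0.
have mas : \sum_(i < n | (r <= i)%N) a i = (n%:R - r%:R) * alpha_star.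
  by rewrite [RHS]mulrC; apply/esym/divfK; rewrite gt_eqF.
have natC (k : nat) : k%:R = (k%:R)%:C%C :> R[i] by rewrite rmorph_nat.
have tr_coproj : \tr ((1%:M + E) *m (1%:M - V *m V ^t*))
    = (\sum_(i < n | (r <= i)%N) a i)%:C%C.
  rewrite IE coproj (mxtrace_mul_congdiag_unitary _ _ ZZ); congr (_%:C%C).
  rewrite (eq_bigr (fun i : 'I_n => if (i < r)%N then 0 else a i)).
    by rewrite big_split_lt /= big1_eq add0r.
  by move=> i _; case: ifP => _; rewrite ?mulr0 ?mulr1.
(* What remains depends on the matrices only through [AE], [PaE], [P1] and
   [tr_coproj]. *)
clearbody P P_ W.
clear hV hD VdV VV DE IDE coproj IE one_diag Eb EZ ZZ hE PE.
have q0 al : 0 < al -> forall i, q al i != 0.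
  by move=> al0; exact: flatten_tail_neq0.
have dvgE al : 0 < al -> logdet_div A (P_ al)
    = (n%:R - r%:R) * (alpha_star / al - 1 + ln al) + - ln c.
  move=> al0; rewrite AE PaE (logdet_div_congdiag _ uW (q0 _ al0)).
  rewrite (sum_ratio_flatten_tail le_rn a0).
  rewrite (ln_prod_ratio_flatten_tail le_rn a0 al0) mas -/c.
  by ring.
have trE al : 0 < al -> \tr (invmx (P_ al) *m A)
    = (r%:R + (n%:R - r%:R) * alpha_star / al)%:C%C.
  move=> al0; rewrite AE PaE (mxtrace_mul_invmx_congdiag _ uW (q0 _ al0)).
  by rewrite (sum_ratio_flatten_tail le_rn a0) mas.
have detE al : 0 < al -> rdet (invmx (P_ al) *m A)
    = \prod_i (a i / q al i).
  move=> al0; rewrite AE PaE /rdet.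
  by rewrite (det_mul_invmx_congdiag _ uW (q0 _ al0)).
have lndetE al : 0 < al -> ln (rdet (invmx (P_ al) *m A))
    = ln c - (n%:R - r%:R) * ln al.
  move=> al0; rewrite (detE _ al0).
  by rewrite (ln_prod_ratio_flatten_tail le_rn a0 al0).
have det_gt0 : 0 < rdet (invmx (P_ alpha_star) *m A).
  rewrite (detE _ as0); apply: prodr_gt0 => i _.
  by rewrite ratio_flatten_tail //; case: ifP => // _; exact: divr_gt0.
have lnK : ln (kaporin (invmx (P_ alpha_star) *m A))
    = - ln (rdet (invmx (P_ alpha_star) *m A)).
  have n0 : n%:R != 0 :> R.
    by rewrite pnatr_eq0 -lt0n (leq_ltn_trans (leq0n r)).
  have trn : rtrace (invmx (P_ alpha_star) *m A) = n%:R.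
    by rewrite /rtrace (trE _ as0) /= mulfK ?gt_eqF // subrKC.
  by rewrite /kaporin trn (mulVf n0) expr1n div1r (lnV det_gt0).
split.
- by rewrite tr_coproj !natC -rmorphB -fmorphV -rmorphM.
- rewrite P1 (trE _ ltr01) divr1 -mas !natC -!rmorphB -fmorphV -rmorphM.
  by rewrite [r%:R + _]addrC addrK.
- exact: unique_minimiser_log m0 as0 dvgE.
- split; [|exact: lnK|].
    rewrite lnK (dvgE _ as0) (lndetE _ as0) divff ?gt_eqF //; ring.
  by rewrite P1 (lndetE _ as0) (lndetE _ ltr01) ln1 mulr0 subr0 opprB addrC.
Qed.
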